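(* If $T$ is a locally finite tree with finitely many ends, then $\zeta(T)\le 2$.
   Context: All graphs are simple, connected, and locally finite. A ray is a one-way infinite path; two rays are equivalent if some third ray shares infinitely many vertices with each of them; an end is an equivalence class of rays. The Localization game on a graph $G$ with $k$ cops: the robber moves first, occupying a vertex; in each later robber move the robber moves to a neighboring vertex or stays put. On each cop move, the cops choose vertices $u_1,\dots,u_k$ (arbitrary) and learn the distances $d_i$ from each $u_i$ to the robber's current vertex. The cops capture the robber if after finitely many rounds they can determine the robber's vertex uniquely; otherwise the robber wins. The robber is omniscient. The localization number $\zeta(G)$ is the smallest cardinal $k$ such that $k$ cops have a winning strategy. *)

(* Defs.v *)
From mathcomp Require Import all_boot.
From mathcomp Require Import boolp classical_sets functions cardinality.

Set Implicit Arguments.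
Unset Strict Implicit.
Unset Printing Implicit Defensive.

Local Open Scope classical_set_scope.
Local Open Scope card_scope.

(* A graph is given by its adjacency relation [e] on an arbitrary, possibly
   infinite, vertex type.  Classically, every type carries a [choiceType]
   structure and every binary relation is boolean, so neither restricts the
   class of graphs considered. *)
Section Graphs.
Variables (V : choiceType) (e : rel V).

Definition simple_graph : Prop := symmetric e /\ irreflexive e.

Definition joined_by (x y : V) (n : nat) : Prop :=
  exists p : seq V, [/\ path e x p, last x p = y & size p = n].

Definition connected_graph : Prop :=
  inhabited V /\ forall x y : V, exists n : nat, joined_by x y n.

(* [cycle] also accepts cyclic sequences of length at most 2; an edge
   traversed back and forth is one of these, hence the bound on the size. *)
Definition acyclic_graph : Prop :=
  forall c : seq V, 2 < size c -> ~ ucycle e c.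

Definition tree : Prop := [/\ simple_graph, connected_graph & acyclic_graph].

Definition locally_finite : Prop :=
  forall x : V, finite_set [set y : V | e x y].

(* The default value 0 is only reached when [x] and [y] are not connected. *)
Definition graph_dist (x y : V) : nat :=
  xget 0 [set n | joined_by x y n /\ forall m, joined_by x y m -> n <= m].

Definition ray (r : nat -> V) : Prop :=
  injective r /\ forall n : nat, e (r n) (r n.+1).

Definition ray_equiv (r1 r2 : nat -> V) : Prop :=
  exists r3 : nat -> V,
    [/\ ray r3, infinite_set (range r3 `&` range r1)
      & infinite_set (range r3 `&` range r2)].

Definition ends : set (set (nat -> V)) :=
  [set E | exists2 r, ray r & E = [set r' | ray r' /\ ray_equiv r r']].

End Graphs.

Section LocalizationGame.
Variables (V : choiceType) (e : rel V).

(* [r n] is the vertex occupied by the robber when the cops make their move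
   number [n] (starting from 0). *)
Definition robber_play (r : nat -> V) : Prop :=
  forall n : nat, r n.+1 = r n \/ e (r n) (r n.+1).

(* The cops are indexed by a type [K], so that their number may be any
   cardinal.  The next probe is computed from the distances learned so far;
   earlier probes need not be recorded, since the strategy determines them
   from the earlier distances. *)
Definition cop_strategy (K : Type) : Type := seq (K -> nat) -> K -> V.

(* The distances learned in the first [n] cop moves. *)
Fixpoint observations (K : Type) (s : cop_strategy K) (r : nat -> V) (n : nat)
    : seq (K -> nat) :=
  if n is m.+1 then
    let h := observations s r m in
    rcons h (fun i => graph_dist e (s h i) (r m))
  else [::].

(* After cop move number [n], every robber play compatible with what the cops
   have learned is at the same vertex. *)
Definition located (K : Type) (s : cop_strategy K) (r : nat -> V) (n : nat)
    : Prop :=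
  forall r' : nat -> V, robber_play r' ->
    observations s r' n.+1 = observations s r n.+1 -> r' n = r n.

(* The robber is omniscient, so the strategy has to succeed against all robber
   plays, including those that anticipate the future probes. *)
Definition winning_strategy (K : Type) (s : cop_strategy K) : Prop :=
  forall r : nat -> V, robber_play r -> exists n : nat, located s r n.

Definition cops_win (K : Type) : Prop :=
  exists s : cop_strategy K, winning_strategy s.

(* The cardinality of [K] is the localization number: the least cardinal,
   among all cardinals, of a team of cops with a winning strategy. *)
Definition is_localization_number (K : Type) : Prop :=
  cops_win K /\
  forall K' : Type, cops_win K' -> [set: K] #<= [set: K'].

End LocalizationGame.

(* Main.v *)
Require Import Defs.
From mathcomp Require Import all_boot zify.
From mathcomp Require Import boolp classical_sets functions cardinality.

(* Root the tree at [o]. One cop always probes [o], so the level of the robber is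
   known; the other cop probes a child [c] of [v] and thereby learns whether the
   robber is below [c]. A robber confined strictly below [v] cannot leave this
   region through [v] without being located there, so the children of [v] can be
   tested one at a time: if the cops win below every child of [v], they win
   below [v] (call [v] good). Hence every bad vertex has a bad child, and
   following a preferred bad child traces a ray. Bad vertices that are not the
   preferred child of their parent start rays in pairwise distinct ends, so with
   finitely many ends their levels are bounded. Beyond that bound, the bad vertices
   below a bad [v] form a single ray, and probing a vertex far out on this ray
   tells at which of its vertices the robber's branch is attached; that branch
   only leads to good children, so [v] is good after all. Thus no vertex is bad. *)

Set Implicit Arguments.
Unset Strict Implicit.
Unset Printing Implicit Defensive.

Local Open Scope classical_set_scope.
Local Open Scope card_scope.

(** * Path distance as a metric *)

Section Distance.
Variables (V : choiceType) (e : rel V).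
Hypotheses (sym_e : symmetric e) (conn_e : connected_graph e).

Local Notation d := (graph_dist e).

Lemma graph_distP x y :
  joined_by e x y (d x y) /\ forall m, joined_by e x y m -> d x y <= m.
Proof.
apply: (@xgetPex _ 0
  [set n | joined_by e x y n /\ forall m, joined_by e x y m -> n <= m]).
have exP : exists n, `[< joined_by e x y n >].
  by have [n xy] := conn_e.2 x y; exists n; apply/asboolP.
case: (ex_minnP exP) => n /asboolP xy min_n.
by exists n; split=> // m xym; apply/min_n/asboolP.
Qed.

Lemma graph_dist_joined x y : joined_by e x y (d x y).
Proof. by have [] := graph_distP x y. Qed.

Lemma graph_dist_min x y n : joined_by e x y n -> d x y <= n.
Proof. by have [_] := graph_distP x y; apply. Qed.

Lemma joined_by_trans x y z m n :
  joined_by e x y m -> joined_by e y z n -> joined_by e x z (m + n).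
Proof.
move=> [p [xp py <-]] [q [yq qz <-]]; exists (p ++ q); split.
- by rewrite cat_path xp py.
- by rewrite last_cat py.
- by rewrite size_cat.
Qed.

Lemma joined_by_edge x y : e x y -> joined_by e x y 1.
Proof. by move=> exy; exists [:: y]; rewrite /= exy. Qed.

Lemma joined_by_sym x y n : joined_by e x y n -> joined_by e y x n.
Proof.
move=> [p [+ + <-]]; elim: p x => [|z p IHp] x /=; first by move=> _ <-; exists [::].
move=> /andP[exz zp] lzp; rewrite -addn1.
by apply: joined_by_trans (IHp z zp lzp) (joined_by_edge _); rewrite sym_e.
Qed.

Lemma graph_distxx x : d x x = 0.
Proof. by apply/eqP; rewrite -leqn0; apply: graph_dist_min; exists [::]. Qed.

Lemma graph_dist_sym x y : d x y = d y x.
Proof.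
by apply/eqP; rewrite eqn_leq !graph_dist_min //;
  apply/joined_by_sym/graph_dist_joined.
Qed.

Lemma graph_dist_triangle y x z : d x z <= d x y + d y z.
Proof. by apply/graph_dist_min/joined_by_trans; apply: graph_dist_joined. Qed.

Lemma graph_dist_edge x y : e x y -> d x y <= 1.
Proof. by move=> /joined_by_edge/graph_dist_min. Qed.

Lemma graph_dist_eq0 x y : d x y = 0 -> x = y.
Proof. by have := graph_dist_joined x y; case=> p [_ <- <-] /size0nil ->. Qed.

End Distance.

(** * Rooted trees *)

Section RootedTree.
Variables (V : choiceType) (e : rel V) (o : V).
Hypotheses (sym_e : symmetric e) (irr_e : irreflexive e).
Hypotheses (conn_e : connected_graph e) (acy_e : acyclic_graph e).

Local Notation d := (graph_dist e).
Local Notation lv := (d o).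

(** The default makes a vertex of level 0 its own parent, so [parent] can be iterated freely. *)
Definition parent (x : V) : V :=
  xget x [set y | e y x /\ lv x = (lv y).+1].

Lemma level_edge x y : e x y -> lv y <= (lv x).+1.
Proof.
move=> exy; rewrite -addn1.
apply: leq_trans (graph_dist_triangle conn_e x _ _) _.
by rewrite leq_add2l; apply: graph_dist_edge.
Qed.

Lemma parentP x : 0 < lv x -> e (parent x) x /\ lv x = (lv (parent x)).+1.
Proof.
move=> x_gt0; apply: (@xgetPex _ x [set y | e y x /\ lv x = (lv y).+1]).
have [p [+ + sp]] := graph_dist_joined conn_e o x.
case: (lastP p) sp => [|q y]; first by move=> sp; rewrite -sp in x_gt0.
rewrite size_rcons rcons_path last_rcons => sq /andP[oq elx] ylx; subst y.
exists (last o q); split=> //; apply/eqP; rewrite eqn_leq level_edge //=.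
by rewrite -sq ltnS; apply: (graph_dist_min conn_e); exists q.
Qed.

Lemma level_parent x : lv (parent x) = (lv x).-1.
Proof.
have [x0|/parentP[_ ->//]] := posnP (lv x).
rewrite /parent; case: xgetP => [y _ [_]|_]; first by rewrite x0.
by rewrite x0.
Qed.

Lemma level_iter_parent n x : lv (iter n parent x) = lv x - n.
Proof. by elim: n => [|n /= IHn]; rewrite ?subn0 // level_parent IHn subnS. Qed.

(* Walking up from [x] and [y] in parallel until the two walks meet. *)
Lemma level_bypass x y : x <> y -> lv x = lv y ->
  exists p, [/\ 0 < size p, path e x (rcons p y), uniq (x :: rcons p y)
             & forall z, z \in p -> lv z < lv x].
Proof.
move En : (lv x) => n; elim: n x y En => [|n IHn] x y lx xy ly.
  case: xy; rewrite -(graph_dist_eq0 conn_e lx).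
  by rewrite -(graph_dist_eq0 conn_e (esym ly)).
have [ex lpx] : e (parent x) x /\ lv x = (lv (parent x)).+1.
  by apply: parentP; rewrite lx.
have [ey lpy] : e (parent y) y /\ lv y = (lv (parent y)).+1.
  by apply: parentP; rewrite -ly.
have lpxE : lv (parent x) = n by lia.
have lpyE : lv (parent y) = n by lia.
have [pxy|pxy] := eqVneq (parent x) (parent y).
  exists [:: parent x]; split=> //=.
  - by rewrite sym_e ex pxy ey.
  - rewrite !inE andbT !negb_or -andbA; apply/and3P; split.
    + by apply/eqP => xE; rewrite -xE in lpxE; lia.
    + exact/eqP.
    + by apply/eqP => xE; rewrite xE in lpxE; lia.
  - by move=> z; rewrite inE => /eqP ->; lia.
have [p [_ xp up lp]] := IHn _ _ lpxE (elimN eqP pxy) (esym lpyE).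
have lq z : z \in parent x :: rcons p (parent y) -> lv z < n.+1.
  rewrite inE mem_rcons inE => /or3P[/eqP->|/eqP->|/lp]; lia.
exists (parent x :: rcons p (parent y)); split=> //.
- by rewrite /= rcons_path last_rcons sym_e ex xp ey.
- rewrite cons_uniq rcons_uniq up andbT mem_rcons inE negb_or.
  rewrite -andbA; apply/and3P; split; first exact/eqP.
    by apply/negP => /lq; rewrite lx ltnn.
  by apply/negP => /lq; rewrite -ly ltnn.
Qed.

(** Otherwise a bypass through lower levels, closed by the edge itself, would be a cycle. *)
Lemma level_edge_neq x y : e x y -> lv x <> lv y.
Proof.
move=> exy lxy; have xy : x <> y by move=> xy; rewrite xy irr_e in exy.
have [p [p_gt0 xp up _]] := level_bypass xy lxy.
apply: (acy_e (c := x :: rcons p y)); first by rewrite /= size_rcons !ltnS.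
by rewrite /ucycle up andbT /= rcons_path xp last_rcons sym_e.
Qed.

(** Two such neighbors share a level, and their bypass stays under [z], so it closes to a cycle
    through [z]. *)
Lemma lower_neighbor_unique x x' z :
  e x z -> e x' z -> lv x < lv z -> lv x' < lv z -> x = x'.
Proof.
move=> exz ex'z xz x'z; apply: contrapT => xx'.
have lxx' : lv x = lv x'.
  have := level_edge exz; have := level_edge ex'z; lia.
have [p [p_gt0 xp up lp]] := level_bypass xx' lxx'.
apply: (acy_e (c := z :: x :: rcons p x')); first by rewrite /= size_rcons.
rewrite /ucycle cons_uniq up andbT; apply/andP; split.
  by rewrite /= rcons_path sym_e exz xp last_rcons.
apply/negP; rewrite inE mem_rcons inE => /or3P[/eqP|/eqP|/lp]; last lia.
  by move=> zx; rewrite zx ltnn in xz.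
by move=> zx; rewrite zx ltnn in x'z.
Qed.

Lemma edge_parent x y : e x y ->
  (parent y = x /\ lv y = (lv x).+1) \/ (parent x = y /\ lv x = (lv y).+1).
Proof.
move=> exy; have eyx : e y x by rewrite sym_e.
have := level_edge exy; have := level_edge eyx; have := level_edge_neq exy.
have [xy _ _ yx|yx _ xy _|//] := ltngtP (lv x) (lv y); [left|right].
  split; last lia; have [ey ly] : e (parent y) y /\ lv y = (lv (parent y)).+1.
    by apply: parentP; lia.
  by apply: (@lower_neighbor_unique _ _ y) => //; lia.
split; last lia; have [ex lx] : e (parent x) x /\ lv x = (lv (parent x)).+1.
  by apply: parentP; lia.
by apply: (@lower_neighbor_unique _ _ x) => //; lia.
Qed.

Definition child (v c : V) : Prop := parent c = v /\ lv c = (lv v).+1.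

Lemma child_edge v c : child v c -> e v c.
Proof. by move=> [<- lc]; have [|//] := @parentP c; rewrite lc. Qed.

Definition below (v x : V) : Prop :=
  lv v <= lv x /\ iter (lv x - lv v) parent x = v.

Lemma below_refl v : below v v.
Proof. by split=> //; rewrite subnn. Qed.

Lemma below_root x : below o x.
Proof.
split; first by rewrite graph_distxx.
apply/esym/(graph_dist_eq0 conn_e).
by rewrite level_iter_parent graph_distxx // subn0 subnn.
Qed.

Lemma below_trans w v x : below v w -> below w x -> below v x.
Proof.
move=> [vw vwE] [wx wxE]; split; first exact: leq_trans wx.
have -> : lv x - lv v = (lv w - lv v) + (lv x - lv w) by lia.
by rewrite iterD wxE vwE.
Qed.

Lemma below_child v c : child v c -> below v c.
Proof. by move=> [pc lc]; split; rewrite lc // subSnn. Qed.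

Lemma below_level_eq v x : below v x -> lv v = lv x -> x = v.
Proof. by move=> [_ vE] vx; rewrite vx subnn in vE. Qed.

Lemma below_inter v w x : below v x -> below w x -> lv v <= lv w -> below v w.
Proof.
move=> [vx vE] [wx wE] vw; split=> //; rewrite -{2}wE -iterD.
by rewrite -[RHS]vE; congr iter; lia.
Qed.

Lemma below_properly v x : below v x -> x <> v ->
  exists2 c, child v c & below c x.
Proof.
move=> [vx vE] xv; have {}vx : lv v < lv x.
  rewrite ltn_neqAle vx andbT; apply/eqP => lvx.
  by apply: xv; rewrite -vE lvx subnn.
have lc : lv (iter (lv x - (lv v).+1) parent x) = (lv v).+1.
  by rewrite level_iter_parent; lia.
exists (iter (lv x - (lv v).+1) parent x).
  by split=> //; rewrite -iterS -[RHS]vE subnSK.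
by split; rewrite lc.
Qed.

(** A step to a child stays below [c]; a step to the parent leaves only from [c]. So the robber
    cannot change branches without visiting the vertex above. *)
Lemma below_step c x y : below c x -> e x y ->
  below c y \/ (x = c /\ y = parent c).
Proof.
move=> cx /edge_parent[[py ly]|[px lx]].
  by left; apply: (below_trans cx); apply: below_child.
have [xc|/eqP xc] := eqVneq x c; first by right; split; rewrite -?xc.
left; have [c' [pc' lc'] [lx' c'x]] := below_properly cx xc.
split; first by lia.
have [lc E] := cx; rewrite -{2}E.
have -> : lv x - lv c = (lv y - lv c).+1 by lia.
by rewrite iterSr px.
Qed.

Lemma below_dist c x : below c x -> lv c + d c x = lv x.
Proof.
move=> [cx cE].
apply/eqP; rewrite eqn_leq (graph_dist_triangle conn_e) andbT.
suff /(_ (lv x - lv c) (leq_subr _ _)) :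
    forall n, n <= lv x -> d (iter n parent x) x <= n.
  by rewrite cE; lia.
elim=> [|n IHn] nx; first by rewrite graph_distxx.
have [|en _] := @parentP (iter n parent x).
  by rewrite level_iter_parent; lia.
apply: leq_trans (graph_dist_triangle conn_e (iter n parent x) _ _) _.
by rewrite -add1n leq_add ?(graph_dist_edge conn_e) ?IHn 1?ltnW.
Qed.

(** A path as long as its gain in level goes to a child at every step. Hence probes at the root and
    at [c] decide whether the robber is below [c]. *)
Lemma below_distP c x : below c x <-> lv c + d c x = lv x.
Proof.
split=> [|lcx]; first exact: below_dist.
have [p [+ + sp]] := graph_dist_joined conn_e c x.
rewrite -sp in lcx; elim: p c lcx {sp} => [|y p IHp] c /= lcx.
  by move=> _ ->; apply: below_refl.
move=> /andP[ecy yp] lyp.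
have lx : lv x <= lv y + size p.
  apply: leq_trans (graph_dist_triangle conn_e y _ _) _.
  by rewrite leq_add2l; apply: (graph_dist_min conn_e); exists p.
have [[py ly]|[_ lc]] := edge_parent ecy; last by lia.
by apply: (@below_trans y); [apply: below_child|apply: IHp => //; lia].
Qed.

Lemma dist_common w x y : below w x -> below w y ->
  d x y + (lv w).*2 <= lv x + lv y.
Proof.
move=> /below_dist wx /below_dist wy.
have := graph_dist_triangle conn_e w x y.
by rewrite (graph_dist_sym sym_e conn_e x w); lia.
Qed.

(** Every path from [x] to [y] passes through [v], and levels change by at most one per edge. *)
Lemma dist_separated v c x y : child v c -> below c x -> ~ below c y ->
  lv x + lv y <= d x y + (lv v).*2.
Proof.
move=> [pc lc]; have [p [+ + <-]] := graph_dist_joined conn_e x y.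
elim: p x => [|z p IHp] x /=; first by move=> _ ->.
move=> /andP[exz zp] lzp cx ncy.
have [cz|[xc zc]] := below_step cx exz.
  have := IHp z zp lzp cz ncy; have := level_edge (x := z) (y := x).
  by rewrite sym_e => /(_ exz); lia.
have : lv y <= lv z + size p.
  apply: leq_trans (graph_dist_triangle conn_e z _ _) _.
  by rewrite leq_add2l; apply: (graph_dist_min conn_e); exists p.
by rewrite zc pc xc; lia.
Qed.

End RootedTree.

(** * Winning from a territory *)

Section Territories.
Variables (V : choiceType) (e : rel V) (K : Type).

Local Notation d := (graph_dist e).

(** Branching over all answers keeps every play finite without a uniform bound on its length. *)
Inductive strategy_tree : Type :=
  | Stop
  | Probe (p : K -> V) (f : (K -> nat) -> strategy_tree).

(* The vertices compatible with the answer [dd] to the probe [p], when the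
   robber was known to be in [S] before his last move. *)
Definition territory (S : set V) (p : K -> V) (dd : K -> nat) : set V :=
  [set y | (exists2 x, S x & y = x \/ e x y) /\ (fun i => d (p i) y) = dd].

Fixpoint wins (t : strategy_tree) (S : set V) : Prop :=
  match t with
  | Stop => is_subset1 S
  | Probe p f => forall dd, wins (f dd) (territory S p dd)
  end.

Definition winnable (S : set V) : Prop := exists t, wins t S.

Lemma winnable_subset1 S : is_subset1 S -> winnable S.
Proof. by exists Stop. Qed.

Lemma winnable_probe p S :
  (forall dd, winnable (territory S p dd)) -> winnable S.
Proof. by move=> /choice[f fP]; exists (Probe p f). Qed.

Definition next_probe (o : V) (t : strategy_tree) : K -> V :=
  if t is Probe p _ then p else fun=> o.

Definition after (t : strategy_tree) (dd : K -> nat) : strategy_tree :=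
  if t is Probe _ f then f dd else Stop.

Definition strategy_of (o : V) (t : strategy_tree) : cop_strategy V K :=
  fun h => next_probe o (foldl after t h).

(** Invariant for induction on [t]: after [n.+1] probes the descent in [t0] has reached [t], and
    every compatible play is in [S]. *)
Lemma wins_located o t0 t S n r : robber_play e r -> wins t S ->
  foldl after t0 (observations e (strategy_of o t0) r n.+1) = t ->
  (forall r', robber_play e r' ->
     observations e (strategy_of o t0) r' n.+1 =
     observations e (strategy_of o t0) r n.+1 -> S (r' n)) ->
  exists m, located e (strategy_of o t0) r m.
Proof.
move=> rP; elim: t S n => [|p f IHt] S n tS tE SP.
  by exists n => r' r'P r'r; apply: tS; apply: SP.
set s := strategy_of o t0 in tE SP *.
pose dd := (fun i => d (s (observations e s r n.+1) i) (r n.+1)).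
have sE : s (observations e s r n.+1) = p.
  by rewrite {1}/s /strategy_of tE.
have obsS r' : observations e s r' n.+2 = rcons (observations e s r' n.+1)
    (fun i => d (s (observations e s r' n.+1) i) (r' n.+1)) by [].
apply: (IHt dd _ n.+1 (tS dd)); first by rewrite obsS -cats1 foldl_cat tE.
move=> r' r'P; rewrite !obsS => eq_obs.
have {eq_obs}[r'r ddE] : observations e s r' n.+1 = observations e s r n.+1 /\
    (fun i => d (s (observations e s r' n.+1) i) (r' n.+1)) = dd.
  have E := rcons_inj eq_obs; split; first exact: (congr1 fst E).
  exact: (congr1 snd E).
split; first by exists (r' n); [apply: SP|apply: r'P].
by rewrite -sE -r'r ddE.
Qed.

Lemma winnable_cops_win : inhabited V -> winnable setT -> cops_win e K.
Proof.
move=> [o] [t tT]; exists (strategy_of o t) => r rP.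
case: t tT => [V1|p f pT].
  by exists 0 => r' _ _; apply: V1.
apply: (@wins_located o _ _ _ 0 r rP (pT (fun i => d (p i) (r 0)))) => //.
move=> r' r'P [/= <-]; split=> //.
(* A [territory] includes a robber move before the probe; for the initial placement this move is
   staying put. *)
by exists (r' 0) => //; left.
Qed.

End Territories.

(** * Comparing teams of cops *)

(** Cop [i] of the larger team imitates cop [g i]; reading the answers through [h] recovers those of
    the smaller team. *)
Lemma cops_win_transfer (V : choiceType) (e : rel V) (K L : Type)
    (g : L -> K) (h : K -> L) : cancel h g -> cops_win e K -> cops_win e L.
Proof.
move=> hK [s sW].
pose s' : cop_strategy V L := fun obs i => s (map (fun ob => ob \o h) obs) (g i).
have obsE r n : observations e s r n = map (fun ob => ob \o h) (observations e s' r n).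
  elim: n => //= n ->; rewrite map_rcons; congr rcons.
  by apply/funext => i /=; rewrite /s' hK.
exists s' => r rP; have [n ln] := sW r rP; exists n => r' r'P r'r.
by apply: ln => //; rewrite !obsE r'r.
Qed.

(** Infinite teams exceed every ['I_k] and finite ones transfer to some ['I_j], so a minimum over
    the naturals suffices. *)
Lemma localization_number_le (V : choiceType) (e : rel V) (n : nat) :
  cops_win e 'I_n -> exists k : nat, is_localization_number e 'I_k /\ k <= n.
Proof.
move=> winn; have exW : exists k, `[< cops_win e 'I_k >].
  by exists n; apply/asboolP.
case: (ex_minnP exW) => k /asboolP wink min_k.
exists k; split; last by apply/min_k/asboolP.
split=> // K winK; have card_k : [set: 'I_k] #= `I_k.
  by apply: card_esym; apply: card_II.
rewrite (card_le_eql card_k).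
have [/finite_setP[j Kj]|/infiniteP infK] := pselect (finite_set [set: K]); last first.
  by apply: card_le_trans infK; apply: card_leT.
rewrite (card_le_eqr Kj); apply: subset_card_le => i /= ik.
apply: leq_trans ik _; apply/min_k/asboolP.
have /card_bijP[f [f' fK f'K]] : [set: K] #= [set: 'I_j].
  by apply: card_eq_trans Kj _; apply: card_II.
apply: (@cops_win_transfer _ _ K 'I_j (fun i => val (f' (SigSub (mem_setT i))))
  (fun x => val (f (SigSub (mem_setT x)))) _ winK) => x.
rewrite (_ : SigSub _ = f (SigSub (mem_setT x))) ?fK //.
exact: val_inj.
Qed.

(** * Confining the robber *)

Section Chase.
Variables (V : choiceType) (e : rel V) (o : V).
Hypotheses (sym_e : symmetric e) (irr_e : irreflexive e).
Hypotheses (conn_e : connected_graph e) (acy_e : acyclic_graph e).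
Hypothesis (lf_e : locally_finite e).

Local Notation d := (graph_dist e).
Local Notation lv := (d o).
Local Notation parent := (parent e o).
Local Notation child := (child e o).
Local Notation below := (below e o).
Local Notation winnable := (winnable e 'I_2).

(* [l] and [n] are the answers of a cop at the root and of a cop at [c]. *)
Definition sphere_step (S : set V) (c : V) (l n : nat) : set V :=
  [set y | [/\ exists2 x, S x & y = x \/ e x y, lv y = l & d c y = n]].

Lemma winnable_root_probe c S :
  (forall l n, winnable (sphere_step S c l n)) -> winnable S.
Proof.
move=> H; apply: (@winnable_probe _ _ _ (fun i => if i == ord0 then o else c)).
move=> dd; have := H (dd ord0) (dd ord_max); congr (winnable _).
apply/seteqP; split=> y /=.
  move=> [Sy ly dy]; split=> //; apply/funext => i.
  have [->|i0] := eqVneq i ord0; first by rewrite -ly.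
  rewrite dy; congr dd; apply/val_inj => /=.
  by case: i i0 => [[|[|]]].
by move=> [Sy ddE]; split=> //; rewrite -ddE.
Qed.

(* The bound on the levels of [S] lets the second cop be placed beyond reach. *)
Definition good (v : V) : Prop := forall S : set V,
  (forall x, S x -> below v x /\ x <> v) ->
  (exists m, forall x, S x -> lv x <= m) -> winnable S.

(** Induction on the children not yet ruled out: the answer to a probe at [c] puts the robber at
    [v], at [c], or strictly below [c], or strikes [c] from the list. *)
Lemma winnable_below_children v (C : seq V) :
  (forall c, c \in C -> child v c /\ good c) ->
  forall S : set V, (forall x, S x -> exists2 c, c \in C & below c x) ->
  winnable S.
Proof.
elim: C => [|c C IHC] goodC S SC.
  by apply: winnable_subset1 => x y /SC[].
have [[pc lc] gc] := goodC c (mem_head _ _).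
apply: (winnable_root_probe (c := c)) => l n.
have stepE y : sphere_step S c l n y ->
    y = v \/ exists2 c', c' \in c :: C & below c' y.
  move=> [[x /SC[c' c'C c'x] +] _ _]; case=> [->|exy]; first by right; exists c'.
  have [c'y|[_ yc']] := below_step sym_e irr_e conn_e acy_e c'x exy.
    by right; exists c'.
  by left; rewrite yc'; have [[]] := goodC c' c'C.
have [lvv|lv_neq] := eqVneq l (lv v).
  apply: winnable_subset1; suff eq_v y : sphere_step S c l n y -> y = v.
    by move=> x y /eq_v -> /eq_v ->.
  move=> Sy; have [//|[c' c'C [c'y _]]] := stepE y Sy.
  by have [_ ly _] := Sy; have [[_]] := goodC c' c'C; lia.
have [ln|ln] := eqVneq (lv c + n) l.
  have below_c y : sphere_step S c l n y -> below c y.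
    by move=> [_ ly dy]; apply/below_distP => //; rewrite dy ly.
  have [lc_l|lc_l] := eqVneq (lv c) l.
    apply: winnable_subset1; suff eq_c y : sphere_step S c l n y -> y = c.
      by move=> x y /eq_c -> /eq_c ->.
    move=> Sy; apply: (below_level_eq (below_c y Sy)).
    by have [_ ->] := Sy.
  apply: gc => [y Sy|]; last by exists l => y [_ ->].
  split; first exact: below_c.
  by move=> yc; have [_ ly _] := Sy; rewrite -ly yc eqxx in lc_l.
apply: IHC => [c' c'C|y Sy]; first by apply: goodC; rewrite inE c'C orbT.
have [yv|[c' + c'y]] := stepE y Sy.
  by have [_ ly _] := Sy; rewrite -ly yv eqxx in lv_neq.
rewrite inE => /predU1P[c'c|]; last by exists c'.
move: c'y; rewrite c'c => /below_distP -/(_ sym_e irr_e conn_e acy_e) cy.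
by have [_ ly dy] := Sy; rewrite -dy cy ly eqxx in ln.
Qed.

Lemma children_seq v : exists C : seq V, forall c, child v c -> c \in C.
Proof.
have /finite_seqP[C CE] := lf_e v; exists C => c vc.
by have : [set` C] c by rewrite -CE; apply: (child_edge conn_e vc).
Qed.

(** Only children whose branches meet [S] must be good; at a chain vertex this leaves out the bad
    next one. *)
Lemma winnable_good_branches v (S : set V) :
  (forall x, S x -> [/\ below v x, x <> v
     & forall c, child v c -> below c x -> good c]) ->
  winnable S.
Proof.
move=> SP; have [C CP] := children_seq v.
pose C' := [seq c <- C | `[< child v c /\ good c >]].
apply: (@winnable_below_children v C') => [c|x /SP[vx xv gx]].
  by rewrite mem_filter => /andP[/asboolP[vc gc] _].
have [c vc cx] := below_properly conn_e vx xv.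
exists c => //; rewrite mem_filter CP // andbT; apply/asboolP.
by split=> //; apply: gx.
Qed.

Lemma good_children v : (forall c, child v c -> good c) -> good v.
Proof.
move=> gC S SP _; apply: (@winnable_good_branches v) => x /SP[vx xv].
by split=> // c vc _; apply: gC.
Qed.

Definition preferred (v : V) : V := xget v [set c | child v c /\ ~ good c].

Lemma preferredP v : ~ good v -> child v (preferred v) /\ ~ good (preferred v).
Proof.
move=> bv; apply: (@xgetPex _ v [set c | child v c /\ ~ good c]).
apply: contrapT => noc; apply: bv; apply: good_children => c vc.
by apply: contrapT => bc; apply: noc; exists c.
Qed.

Definition chain (v : V) (i : nat) : V := iter i preferred v.

(** * Chains of bad vertices *)

Section PreferredChain.
Variable v : V.
Hypothesis bad_v : ~ good v.

Local Notation R := (chain v).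

Lemma chain_bad i : ~ good (R i).
Proof. by elim: i => //= i /preferredP[]. Qed.

Lemma chain_child i : child (R i) (R i.+1).
Proof. by have [] := preferredP (chain_bad (i := i)). Qed.

Lemma chain_level i : lv (R i) = lv v + i.
Proof.
elim: i => [|i IHi]; first by rewrite addn0.
by have [_ ->] := chain_child i; rewrite IHi addnS.
Qed.

Lemma chain_below i j : i <= j -> below (R i) (R j).
Proof.
elim: j => [|j IHj]; first by rewrite leqn0 => /eqP ->; apply: below_refl.
rewrite leq_eqVlt => /predU1P[->|]; first exact: below_refl.
rewrite ltnS => /IHj ij.
exact: (below_trans ij (below_child (chain_child j))).
Qed.

Lemma chain_ray : ray e R.
Proof.
split=> [i j Rij|n]; last exact: (child_edge conn_e (chain_child n)).
by apply: (@addnI (lv v)); rewrite -!chain_level Rij.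
Qed.

Lemma chain_last_above x : below v x ->
  exists i, below (R i) x /\ ~ below (R i.+1) x.
Proof.
move=> vx; apply: contrapT => noi.
have RP i : below (R i) x.
  elim: i => // i IHi; apply: contrapT => ni.
  by apply: noi; exists i.
by have [+ _] := RP (lv x).+1; rewrite chain_level; lia.
Qed.

(* A cop far out on the chain separates the finitely many candidate branching
   points, since the distance decreases with the level of the branching point. *)
Lemma good_single_chain :
  (forall w c, below v w -> child w c -> ~ good c -> c = preferred w) -> good v.
Proof.
move=> uniq_bad S SP [m Sm].
(* After one robber move all levels are at most [m.+1], so no branching point lies beyond
   [R m.+1]. *)
apply: (winnable_root_probe (c := R m.+1)) => l n.
have stepP y : sphere_step S (R m.+1) l n y -> below v y /\ lv y <= m.+1.
  move=> [[x Sx +] _ _]; have [vx xv] := SP x Sx; have lx := Sm x Sx.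
  case=> [->|exy]; first by split=> //; lia.
  split; last by have := level_edge o conn_e exy; lia.
  by have [|[/xv]] := below_step sym_e irr_e conn_e acy_e vx exy.
have [[y0 Sy0]|noy] := pselect (exists y, sphere_step S (R m.+1) l n y); last first.
  by apply: winnable_subset1 => y z Sy; case: noy; exists y.
(* At equal levels, branching off later means being strictly closer to [R m.+1]: compare the lower
   bound for [x] with the upper bound for [y]. *)
have no_lt i j x y : i < j -> sphere_step S (R m.+1) l n x ->
    sphere_step S (R m.+1) l n y -> ~ below (R i.+1) x -> below (R j) y -> False.
  move=> ij Sx Sy nix jy; have [_ ly] := stepP y Sy.
  have [jl _] := jy; rewrite chain_level in jl.
  have jm : j <= m.+1 by lia.
  have := dist_separated sym_e irr_e conn_e acy_e (chain_child i)
    (chain_below (leq_trans ij jm)) nix.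
  have := dist_common sym_e conn_e (chain_below jm) jy.
  have [_ lxE dxE] := Sx; have [_ lyE dyE] := Sy.
  by rewrite dxE dyE lxE lyE !chain_level; lia.
have [i [iy0 niy0]] := chain_last_above (stepP y0 Sy0).1.
have same y : sphere_step S (R m.+1) l n y -> below (R i) y /\ ~ below (R i.+1) y.
  move=> Sy; have [j [jy njy]] := chain_last_above (stepP y Sy).1.
  have [ij|ji|->//] := ltngtP i j.
    by have := no_lt i j y0 y ij Sy0 Sy niy0 jy.
  by have := no_lt j i y y0 ji Sy Sy0 njy iy0.
have [lRi|lRi] := eqVneq l (lv (R i)).
  apply: winnable_subset1; suff eq_R y : sphere_step S (R m.+1) l n y -> y = R i.
    by move=> x y /eq_R -> /eq_R ->.
  move=> Sy; apply: (below_level_eq (same y Sy).1).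
  by have [_ ->] := Sy.
apply: (@winnable_good_branches (R i)) => y Sy; have [iy niy] := same y Sy.
split=> // [yR|c Rc cy]; first by have [_ ly _] := Sy; rewrite -ly yR eqxx in lRi.
(* A bad [c] would be the next chain vertex, which is not above [y]. *)
apply: contrapT => bc; apply: niy.
have -> // : R i.+1 = c.
by apply/esym/uniq_bad => //; apply: (@chain_below 0).
Qed.

End PreferredChain.

(** * Rays, ends and stray vertices *)

(* Once a ray steps away from the root it cannot turn back. *)
Lemma ray_descends r : ray e r ->
  exists N, forall n, N <= n -> child (r n) (r n.+1).
Proof.
move=> [r_inj r_edge].
have [[N cN]|noN] := pselect (exists N, child (r N) (r N.+1)).
  exists N; elim=> [|n IHn]; first by rewrite leqn0 => /eqP <-.
  rewrite leq_eqVlt => /predU1P[<-//|/IHn[pn ln]].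
  (* Turning back would lead to the parent [r n], a repeated vertex. *)
  have [//|[]] := edge_parent o sym_e irr_e conn_e acy_e (r_edge n.+1).
  by rewrite pn => /r_inj; lia.
(* With no step away from the root, the level would drop at every step forever. *)
have down n : lv (r n) + n <= lv (r 0).
  elim: n => [|n IHn]; first by rewrite addn0.
  have [cn|[]] := edge_parent o sym_e irr_e conn_e acy_e (r_edge n).
    by case: noN; exists n.
  by lia.
by have := down (lv (r 0)).+1; lia.
Qed.

Lemma infinite_range_meets (r r' : nat -> V) N :
  infinite_set (range r `&` range r') -> exists n i, N <= n /\ r n = r' i.
Proof.
move=> inf; apply: contrapT => nomeet; apply: inf.
apply: (@sub_finite_set _ _ (r @` `I_N)); last exact/finite_image/finite_II.
move=> _ [[n _ <-] [i _ rni]]; exists n => //=; rewrite ltnNge.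
by apply/negP => Nn; apply: nomeet; exists n, i.
Qed.

(** These are the bad vertices at which a chain starts rather than continues. *)
Definition stray : set V := [set c | ~ good c /\ c <> preferred (parent c)].

(** A common ray, once it moves away from the root, meets the chain of [c] and later that of [c'].
    Hence [c'] is above a vertex of the chain of [c], so lies on that chain, where only the start is
    stray. *)
Lemma stray_equiv_le c c' : stray c -> stray c' -> lv c <= lv c' ->
  ray_equiv e (chain c) (chain c') -> c = c'.
Proof.
move=> [bc sc] [bc' sc'] cc' [r [rP meet meet']].
have [N down] := ray_descends rP.
have r_below i j : N <= i -> i <= j -> below (r i) (r j) /\ lv (r j) = lv (r i) + (j - i).
  move=> Ni; elim: j => [|j IHj].
    by rewrite leqn0 => /eqP ->; rewrite addn0; split=> //; apply: below_refl.
  rewrite leq_eqVlt => /predU1P[->|ij].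
    by rewrite subnn addn0; split=> //; apply: below_refl.
  have [rij lij] := IHj ij; have rj := down j (leq_trans Ni ij).
  split; first exact: (below_trans rij (below_child rj)).
  by rewrite rj.2 lij; lia.
(* The summand [lv c'] ensures that [r n] has at least the level of [c']. *)
have [n [i [Nn rn]]] := infinite_range_meets (N + lv c') meet.
have [k [j [nk rk]]] := infinite_range_meets n meet'.
have [|nkb _] := r_below n k _ nk; first by lia.
have [|_ ln] := r_below N n (leqnn _); first by lia.
have c'k : below c' (r k) by rewrite rk; apply: (chain_below bc' (leq0n j)).
have {nkb c'k}: below c' (r n) by apply: (below_inter c'k nkb); lia.
rewrite rn => c'i; have [lc' _] := c'i; rewrite chain_level // in lc'.
have c'E : c' = chain c (lv c' - lv c).
  have ki : lv c' - lv c <= i by lia.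
  have lk : lv c' = lv (chain c (lv c' - lv c)).
    by rewrite chain_level //; lia.
  apply/esym/(below_level_eq _ lk).
  by apply: (below_inter c'i (chain_below bc ki)); rewrite -lk.
case: (lv c' - lv c) c'E => [//|k' c'E]; case: sc'.
by have [pc' _] := chain_child bc k'; rewrite c'E /= pc'.
Qed.

Lemma ray_equiv_sym r r' : ray_equiv e r r' -> ray_equiv e r' r.
Proof. by move=> [r'' [? ? ?]]; exists r''. Qed.

Lemma ray_equiv_refl r : ray e r -> ray_equiv e r r.
Proof.
move=> rP; have r_inj : {in [set: nat] &, injective r} by move=> i j _ _; apply: rP.1.
have inf : infinite_set (range r `&` range r).
  by rewrite setIid (eq_finite_set (inj_card_eq r_inj)); apply: infinite_nat.
by exists r.
Qed.

Lemma stray_inj c c' : stray c -> stray c' ->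
  ray_equiv e (chain c) (chain c') -> c = c'.
Proof.
move=> sc sc' cc'; have [le|/ltnW le] := leqP (lv c) (lv c').
  exact: stray_equiv_le.
by apply/esym/stray_equiv_le => //; apply: ray_equiv_sym.
Qed.

(** Sending a stray vertex to the end of its chain is injective. *)
Lemma finite_stray : finite_set (ends e) -> finite_set stray.
Proof.
pose F c := [set r | ray e r /\ ray_equiv e (chain c) r].
move=> fin_ends; have F_inj : {in stray &, injective F}.
  move=> c c'; rewrite !inE => sc sc' FF.
  have : F c' (chain c').
    by split; [|apply: ray_equiv_refl]; apply: (chain_ray sc'.1).
  by rewrite -FF => -[_]; apply: stray_inj.
rewrite -(eq_finite_set (inj_card_eq F_inj)).
apply: sub_finite_set fin_ends => _ [c [bc _] <-].
by exists (chain c) => //; apply: chain_ray.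
Qed.

(** A chain from a bad [v] passes the levels of all stray vertices; there [good_single_chain] makes
    a chain vertex good, a contradiction. *)
Lemma all_good v : finite_set (ends e) -> good v.
Proof.
move=> /finite_stray/finite_seqP[s sE]; apply: contrapT => bv.
pose L := \max_(c <- s) lv c.
have low c : stray c -> lv c <= L.
  move=> sc; have cs : [set` s] c by rewrite -sE.
  exact: leq_bigmax_seq.
apply: (chain_bad bv (i := L)); apply: good_single_chain; first exact: chain_bad.
move=> w c [lw _] [pc lc] bc; apply: contrapT => cw.
have sc : stray c by split; rewrite ?pc.
by have := low c sc; rewrite chain_level // in lw; lia.
Qed.

(** The first probe fixes the robber's level and so supplies the bound required by [good o]. *)
Lemma winnable_setT : finite_set (ends e) -> winnable setT.
Proof.
move=> fin_ends; apply: (winnable_root_probe (c := o)) => l n.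
have [l0|l0] := eqVneq l 0.
  apply: winnable_subset1 => x y [_ lx _] [_ ly _].
  rewrite -(@graph_dist_eq0 _ _ conn_e o x) ?lx //.
  by rewrite -(@graph_dist_eq0 _ _ conn_e o y) ?ly.
apply: (all_good (v := o) fin_ends) => [x [_ lx _]|].
  split; first exact: below_root.
  by move=> xo; move: l0; rewrite -lx xo graph_distxx.
by exists l => x [_ ->].
Qed.

End Chase.

Theorem theorem2p4 (V : choiceType) (e : rel V) :
  tree e -> locally_finite e -> finite_set (ends e) ->
  exists k : nat, is_localization_number e 'I_k /\ k <= 2.
Proof.
move=> [[sym_e irr_e] conn_e acy_e] lf_e fin_ends.
apply: localization_number_le; apply: winnable_cops_win; first exact: conn_e.1.
by have [[o] _] := conn_e; exact: (winnable_setT o sym_e).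
Qed.
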